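(* Let $\mathbf E=\{E_i\}_{i=1}^n$ be a POVM on a $d$-dimensional Hilbert space $\mathcal H$, let $\mathbf P$ be a Naimark extension of $\mathbf E$ on $\mathcal H'$ with $\dim\mathcal H'=d'$, and let $\rho,\sigma$ be states on $\mathcal H$. The quantity $F_{\max}(\rho,\sigma)=\max_{\Lambda_{\rm PIC}}F(\Lambda_{\rm PIC}[\rho],\sigma)$, where the maximum is over all POVM-incoherent operations $\Lambda_{\rm PIC}$ of $\mathbf E$, equals the optimal value of the following semidefinite program over operators $X$ on $\mathcal H$ and $J$ on $\mathcal H'\otimes\mathcal H'$: $$\text{maximize}\quad \tfrac12\big(\operatorname{tr}[X]+\operatorname{tr}[X^\dagger]\big)$$ subject to $$\begin{pmatrix}\sigma & X\\ X^\dagger & \Lambda[\rho]\end{pmatrix}\ge 0,\qquad \Lambda[\rho]=\operatorname{vec}^{-1}\big(d'\,\hat{\mathcal E}^\dagger J^R\hat{\mathcal E}\operatorname{vec}(\rho)\big),$$ $$J\ge0,\qquad \operatorname{tr}_1J=\tfrac{\mathbb 1}{d'},\qquad J^R\hat\Delta=\hat\Delta J^R\hat\Delta,\qquad J^R\hat\Omega=\hat\Omega J^R\hat\Omega.$$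
   Context: All Hilbert spaces are finite-dimensional. The fidelity is $F(\rho,\sigma)=\operatorname{tr}\sqrt{\sqrt\rho\,\sigma\sqrt\rho}$. A POVM on $\mathcal H$ is a set $\{E_i\}_{i=1}^n$ of positive semidefinite operators with $\sum_iE_i=\mathbb 1$; a projective measurement is a POVM $\{P_i\}$ with $P_iP_j=\delta_{ij}P_i$ (arbitrary ranks). A channel is a completely positive trace-preserving linear map. Naimark extension of $\mathbf E$: a projective measurement $\mathbf P=\{P_i\}_{i=1}^n$ on a Hilbert space $\mathcal H'$ of dimension $d'\ge d$ containing $\mathcal H$ as a direct summand, such that $\operatorname{tr}[E_i\rho]=\operatorname{tr}[P_i(\rho\oplus 0)]$ for all $i$ and all states $\rho$ on $\mathcal H$. Put $\mathcal E[X]=X\oplus 0$ (embedding of operators on $\mathcal H$ into operators on $\mathcal H'$), $\Pi_{\mathcal E}=\mathbb 1_d\oplus 0_{d'-d}$, $\Omega[X]=\Pi_{\mathcal E}X\Pi_{\mathcal E}$, $\Delta[X]=\sum_iP_iXP_i$; let $\mathcal S'$ be the set of states on $\mathcal H'$, $\mathcal S_{\mathcal E}\subseteq\mathcal S'$ the set of embedded states $\rho\oplus 0$, and $\mathcal I=\{\Delta[\sigma]:\sigma\in\mathcal S'\}$ the set of block-incoherent states. POVM-incoherent operation: a map $\Lambda_{\rm PIC}=\mathcal E^{-1}\circ\Lambda'\circ\mathcal E$ on states of $\mathcal H$, where $\Lambda'$ is a channel on $\mathcal H'$ that is (i) block-incoherent: $\Lambda'[\mathcal I]\subseteq\mathcal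 I$ (equivalently $\Lambda'\circ\Delta=\Delta\circ\Lambda'\circ\Delta$), and (ii) subspace-preserving: $\Lambda'[\mathcal S_{\mathcal E}]\subseteq\mathcal S_{\mathcal E}$. (The set of these maps does not depend on the chosen Naimark extension.) Matrix notation: fix an orthonormal basis of $\mathcal H'$ extending one of $\mathcal H$, and let $\{B_\alpha\}$ be the standard matrix units $|i\rangle\langle j|$ in lexicographical order; $\operatorname{vec}(Y)$ is the coordinate vector of an operator $Y$ in this basis of matrix units. For a linear map $\Phi$ between spaces of operators, $\hat\Phi_{\alpha,\beta}=\operatorname{tr}[B_\alpha^\dagger\Phi[B_\beta]]$ is its matrix, so $\hat\Phi\operatorname{vec}(Y)=\operatorname{vec}(\Phi[Y])$. For an operator $X$ on $\mathcal H'\otimes\mathcal H'$, $X^R=\sum_\alpha(\mathbb 1\otimes B_\alpha)X(B_\alpha\otimes\mathbb 1)$ (row-reshuffling), viewed as a $d'^2\times d'^2$ matrix. $\operatorname{tr}_1$ is the partial trace over the first factor of $\mathcal H'\otimes\mathcal H'$. With these conventions the matrix of a map $\Lambda'$ is $\hat\Lambda'=d'J(\Lambda')^R$, where $J(\Lambda')=\frac1{d'}\sum_{i,j}\Lambda'[|i\rangle\langle j|]\otimes|i\rangle\langle j|$ is the Choi matrix. *)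

(* Defs.v *)
From mathcomp Require Import all_boot all_order all_algebra.
From mathcomp Require Import classical_sets reals.
From mathcomp Require Import complex mxtens.

Set Implicit Arguments.
Unset Strict Implicit.
Unset Printing Implicit Defensive.

Import Order.TTheory GRing.Theory Num.Theory.

Local Open Scope ring_scope.
Local Open Scope sesquilinear_scope.
Local Open Scope classical_set_scope.

(* The complex numbers are R[i] with R : realType.
   Operators on an n-dimensional space are n x n matrices acting on column
   vectors, and [M ^t*] is the adjoint of M. *)

(* In the order of C, [0 <= z] says that z is real and nonnegative; hence the
   condition forces A to be Hermitian. *)
Definition psd (C : numClosedFieldType) n (A : 'M[C]_n) : Prop :=
  forall u : 'cV[C]_n, 0 <= (u ^t* *m A *m u) 0 0.

Definition density (C : numClosedFieldType) n : set 'M[C]_n :=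
  [set rho | psd rho /\ \tr rho = 1].

(* Functional calculus in the spectral decomposition
   [A = invmx (spectralmx A) *m diag_mx (spectral_diag A) *m spectralmx A],
   with [spectralmx A] unitary, which holds for every normal A. *)
Definition sqrtmx (C : numClosedFieldType) n (A : 'M[C]_n) : 'M[C]_n :=
  invmx (spectralmx A) *m diag_mx (map_mx sqrtC (spectral_diag A))
    *m spectralmx A.

(* For positive semidefinite arguments the trace is a nonnegative real, so that
   [Re] is only a cast to R. *)
Definition fidelity (R : realType) n (rho sigma : 'M[R[i]]_n) : R :=
  complex.Re (\tr (sqrtmx (sqrtmx rho *m sigma *m sqrtmx rho))).

Definition povm (C : numClosedFieldType) d n (E : 'I_n -> 'M[C]_d) : Prop :=
  (forall i, psd (E i)) /\ \sum_i E i = 1%:M.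

Definition projective_measurement (C : numClosedFieldType) d n
    (P : 'I_n -> 'M[C]_d) : Prop :=
  povm P /\ forall i j, P i *m P j = if i == j then P i else 0.

(* Phi (x) id_r: the (i, j) block of X with respect to the second tensor
   factor is mapped by Phi. *)
Definition ampliation (C : numClosedFieldType) m n
    (Phi : 'M[C]_m -> 'M[C]_n) r (X : 'M[C]_(m * r)) : 'M[C]_(n * r) :=
  \sum_(i < r) \sum_(j < r)
    tensmx (Phi (\matrix_(a, b) X (mxtens_index (a, i)) (mxtens_index (b, j))))
           (delta_mx i j).

Definition completely_positive (C : numClosedFieldType) m n
    (Phi : 'M[C]_m -> 'M[C]_n) : Prop :=
  forall r (X : 'M[C]_(m * r)), psd X -> psd (ampliation Phi X).

Definition channel (C : numClosedFieldType) m n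
    (Phi : 'M[C]_m -> 'M[C]_n) : Prop :=
  [/\ linear Phi, completely_positive Phi & forall X, \tr (Phi X) = \tr X].

(* H' = H (+) C^k, so that d' = d + k. *)
Definition embed (C : numClosedFieldType) d k (X : 'M[C]_d) : 'M[C]_(d + k) :=
  block_mx X 0 0 0.

(* The inverse of [embed] on its range. *)
Definition unembed (C : numClosedFieldType) d k (Y : 'M[C]_(d + k)) : 'M[C]_d :=
  ulsubmx Y.

Definition naimark_extension (C : numClosedFieldType) d k n
    (E : 'I_n -> 'M[C]_d) (P : 'I_n -> 'M[C]_(d + k)) : Prop :=
  projective_measurement P /\
  forall i rho, density rho -> \tr (E i *m rho) = \tr (P i *m embed k rho).

Definition block_dephasing (C : numClosedFieldType) d n (P : 'I_n -> 'M[C]_d)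
    (X : 'M[C]_d) : 'M[C]_d :=
  \sum_i P i *m X *m P i.

Definition subspace_proj (C : numClosedFieldType) d k : 'M[C]_(d + k) :=
  block_mx 1%:M 0 0 0.

Definition subspace_compression (C : numClosedFieldType) d k
    (X : 'M[C]_(d + k)) : 'M[C]_(d + k) :=
  subspace_proj C d k *m X *m subspace_proj C d k.

Definition incoherent_states (C : numClosedFieldType) d n
    (P : 'I_n -> 'M[C]_d) : set 'M[C]_d :=
  block_dephasing P @` @density C d.

Definition embedded_states (C : numClosedFieldType) d k : set 'M[C]_(d + k) :=
  embed k @` @density C d.

Definition block_incoherent (C : numClosedFieldType) d n
    (P : 'I_n -> 'M[C]_d) (Lam : 'M[C]_d -> 'M[C]_d) : Prop :=
  Lam @` incoherent_states P `<=` incoherent_states P.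

Definition subspace_preserving (C : numClosedFieldType) d k
    (Lam : 'M[C]_(d + k) -> 'M[C]_(d + k)) : Prop :=
  Lam @` @embedded_states C d k `<=` @embedded_states C d k.

(* The operations of a POVM E are obtained from any Naimark extension P of E.
   They are maps on states: the value of Lam elsewhere is irrelevant. *)
Definition povm_incoherent_op (C : numClosedFieldType) d k n
    (P : 'I_n -> 'M[C]_(d + k)) (Lam : 'M[C]_d -> 'M[C]_d) : Prop :=
  exists Lam' : 'M[C]_(d + k) -> 'M[C]_(d + k),
    [/\ channel Lam', block_incoherent P Lam', subspace_preserving Lam' &
        forall rho, density rho -> Lam rho = unembed (Lam' (embed k rho))].

(* [mxtens_index (i, j)] is i * n + j: pairs of indices are in lexicographical
   order, for the matrix units as well as for tensor products. *)
Definition matrix_unit (C : numClosedFieldType) n (a : 'I_(n * n)) : 'M[C]_n :=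
  delta_mx (mxtens_unindex a).1 (mxtens_unindex a).2.

Definition vec (C : numClosedFieldType) n (Y : 'M[C]_n) : 'cV[C]_(n * n) :=
  \col_a Y (mxtens_unindex a).1 (mxtens_unindex a).2.

Definition unvec (C : numClosedFieldType) n (v : 'cV[C]_(n * n)) : 'M[C]_n :=
  \matrix_(i, j) v (mxtens_index (i, j)) 0.

Definition map_matrix (C : numClosedFieldType) m n
    (Phi : 'M[C]_m -> 'M[C]_n) : 'M[C]_(n * n, m * m) :=
  \matrix_(a, b) \tr ((matrix_unit C a) ^t* *m Phi (matrix_unit C b)).

Definition reshuffle (C : numClosedFieldType) n (X : 'M[C]_(n * n)) :
    'M[C]_(n * n) :=
  \sum_a tensmx 1%:M (matrix_unit C a) *m X *m tensmx (matrix_unit C a) 1%:M.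

Definition partial_trace1 (C : numClosedFieldType) m n (X : 'M[C]_(m * n)) :
    'M[C]_n :=
  \matrix_(i, j) \sum_(l < m) X (mxtens_index (l, i)) (mxtens_index (l, j)).

Definition sdp_output (C : numClosedFieldType) d k
    (J : 'M[C]_((d + k) * (d + k))) (rho : 'M[C]_d) : 'M[C]_d :=
  let hatE := map_matrix (@embed C d k) in
  unvec ((d + k)%N%:R *: (hatE ^t* *m reshuffle J *m hatE *m vec rho)).

Definition sdp_feasible (C : numClosedFieldType) d k n
    (P : 'I_n -> 'M[C]_(d + k)) (rho sigma : 'M[C]_d)
    (X : 'M[C]_d) (J : 'M[C]_((d + k) * (d + k))) : Prop :=
  let hatDelta := map_matrix (block_dephasing P) in
  let hatOmega := map_matrix (@subspace_compression C d k) in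
  let JR := reshuffle J in
  [/\ psd (block_mx sigma X (X ^t*) (sdp_output J rho)),
      psd J,
      partial_trace1 J = ((d + k)%N%:R^-1)%:M,
      JR *m hatDelta = hatDelta *m JR *m hatDelta &
      JR *m hatOmega = hatOmega *m JR *m hatOmega].

(* The sum of the two traces is real, so that [Re] is only a cast to R. *)
Definition sdp_objective (R : realType) d (X : 'M[R[i]]_d) : R :=
  complex.Re (2^-1 * (\tr X + \tr (X ^t*))).

Definition is_maximum (R : realType) (A : set R) (m : R) : Prop :=
  A m /\ ubound A m.

(* Main.v *)
(* A matrix J satisfies the linear constraints of the program exactly when it is
   the normalised Choi matrix of a block-incoherent, subspace-preserving channel:
   positivity of J is complete positivity, its partial trace encodes trace
   preservation, and the two reshuffled equations are the intertwining relations
   Lam o Delta = Delta o Lam o Delta and Lam o Omega = Omega o Lam o Omega, which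
   are equivalent to the conditions on states because states span all matrices.
   For fixed positive A, B the maximum of Re tr X over positive blocks
   [[B, X], [X^*, A]] is the fidelity |sqrt B sqrt A|_1: with the polar
   decomposition sqrt B sqrt A = U F it is attained at X = sqrt B U sqrt A, and
   it is an upper bound because the block is nonnegative on the columns of
   (B^(-1/2) U F^(1/2), - A^(-1/2) F^(1/2)), with Moore-Penrose inverses.
   Finally the feasible set is compact, so the supremum is a maximum; this is
   also what makes the maximum over operations exist. *)

Require Import Defs.
From HB Require Import structures.
From mathcomp Require Import all_boot all_order all_algebra.
From mathcomp Require Import classical_sets reals.
From mathcomp Require Import complex mxtens.
From mathcomp Require Import boolp topology normedtype derive ring.

Set Implicit Arguments.
Unset Strict Implicit.
Unset Printing Implicit Defensive.

Import Order.TTheory GRing.Theory Num.Theory.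
Import numFieldNormedType.Exports.

Local Open Scope ring_scope.
Local Open Scope sesquilinear_scope.
Local Open Scope classical_set_scope.

(** * Positive semidefinite matrices *)

Section Adjoint.
Variable C : numClosedFieldType.

Lemma trmxC_mul m n p (A : 'M[C]_(m, n)) (B : 'M[C]_(n, p)) :
  (A *m B) ^t* = B ^t* *m A ^t*.
Proof. by rewrite trmx_mul map_mxM. Qed.

Lemma trmxCD m n (A B : 'M[C]_(m, n)) : (A + B) ^t* = A ^t* + B ^t*.
Proof. by rewrite linearD map_mxD. Qed.

Lemma trmxCN m n (A : 'M[C]_(m, n)) : (- A) ^t* = - A ^t*.
Proof. by rewrite linearN map_mxN. Qed.

Lemma trmxCB m n (A B : 'M[C]_(m, n)) : (A - B) ^t* = A ^t* - B ^t*.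
Proof. by rewrite trmxCD trmxCN. Qed.

Lemma trmxCZ m n c (A : 'M[C]_(m, n)) : (c *: A) ^t* = c^* *: A ^t*.
Proof. by rewrite linearZ map_mxZ. Qed.

Lemma trmxC0 m n : (0 : 'M[C]_(m, n)) ^t* = 0.
Proof. by rewrite trmx0 map_mx0. Qed.

Lemma trmxC1 n : (1%:M : 'M[C]_n) ^t* = 1%:M.
Proof. by rewrite trmx1 map_mx1. Qed.

Lemma trmxC_block m1 m2 n1 n2 (A : 'M[C]_(m1, n1)) (B : 'M[C]_(m1, n2))
    (D : 'M[C]_(m2, n1)) (F : 'M[C]_(m2, n2)) :
  (block_mx A B D F) ^t* = block_mx (A ^t*) (D ^t*) (B ^t*) (F ^t*).
Proof. by rewrite tr_block_mx map_block_mx. Qed.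

Lemma trmxC_col m1 m2 n (A : 'M[C]_(m1, n)) (B : 'M[C]_(m2, n)) :
  (col_mx A B) ^t* = row_mx (A ^t*) (B ^t*).
Proof. by rewrite tr_col_mx map_row_mx. Qed.

Lemma trmxC_delta m n i j : (delta_mx i j : 'M[C]_(m, n)) ^t* = delta_mx j i.
Proof. by rewrite trmx_delta map_delta_mx. Qed.

Lemma mxtrace_trmxC n (A : 'M[C]_n) : \tr (A ^t*) = (\tr A)^*.
Proof. by rewrite trace_map_mx mxtrace_tr. Qed.

Lemma mxtrace_gram m n (W : 'M[C]_(m, n)) :
  \tr (W ^t* *m W) = \sum_j \sum_i `|W i j| ^+ 2.
Proof.
apply: eq_bigr => j _; rewrite mxE; apply: eq_bigr => i _.
by rewrite !mxE normCKC.
Qed.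

(** The trace of a Gram matrix is the sum of the squared moduli of all entries of [W]. *)
Lemma gram_eq0 m n (W : 'M[C]_(m, n)) : W ^t* *m W = 0 -> W = 0.
Proof.
move=> /(congr1 mxtrace); rewrite mxtrace_gram mxtrace0 => /eqP.
rewrite psumr_eq0 => [/allP W0|j _]; last by apply: sumr_ge0 => i _; exact: exprn_ge0.
apply/matrixP => i j; rewrite mxE; have := W0 j (mem_index_enum _).
rewrite /= psumr_eq0 => [/allP/(_ i (mem_index_enum _))|k _]; last exact: exprn_ge0.
by rewrite expf_eq0 normr_eq0 => /eqP.
Qed.

(* Polarization. *)
Lemma linear_rank1_eq0 n (V : lmodType C) (L : {linear 'M[C]_n -> V}) :
  (forall u : 'cV[C]_n, L (u *m u ^t*) = 0) -> forall Y, L Y = 0.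
Proof.
move=> L0 Y.
suff Luv (u v : 'cV[C]_n) : L (u *m v ^t*) = 0.
  rewrite (matrix_sum_delta Y) linear_sum big1 // => i _.
  rewrite linear_sum big1 // => j _.
  rewrite linearZ /= -(mul_delta_mx (0 : 'I_1)) -[X in _ *m X]trmxCK trmxC_delta.
  by rewrite Luv scaler0.
have pol (w : 'cV[C]_n) : L (u *m w ^t*) + L (w *m u ^t*) = 0.
  have := L0 (u + w).
  by rewrite trmxCD mulmxDl !mulmxDr !linearD !L0 add0r addr0.
(* Replacing [v] by ['i *: v] makes the two terms of [pol] equal, while [pol v] makes them opposite;
   hence both vanish. *)
have := pol ('i *: v).
rewrite trmxCZ -scalemxAr -scalemxAl !linearZ /= conjCi scaleNr.
rewrite addrC -scalerBr => /eqP.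
rewrite scaler_eq0 (negPf (neq0Ci _)) /= subr_eq0 => /eqP E.
have := pol v; rewrite E -mulr2n => /eqP.
by rewrite -scaler_nat scaler_eq0 pnatr_eq0 => /eqP.
Qed.

End Adjoint.

Section Psd.
Variable C : numClosedFieldType.
Implicit Types n m : nat.

Lemma psd_conj m n (A : 'M[C]_n) (W : 'M[C]_(n, m)) :
  psd A -> psd (W ^t* *m A *m W).
Proof. by move=> hA u; have := hA (W *m u); rewrite trmxC_mul !mulmxA. Qed.

Lemma psd1 n : psd (1%:M : 'M[C]_n).
Proof.
move=> u; rewrite mulmx1 mxE sumr_ge0 // => i _.
by rewrite !mxE -normCKC exprn_ge0.
Qed.

Lemma psd_gram m n (W : 'M[C]_(m, n)) : psd (W ^t* *m W).
Proof. by rewrite -[W ^t*]mulmx1; exact/psd_conj/psd1. Qed.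

Lemma psdD n (A B : 'M[C]_n) : psd A -> psd B -> psd (A + B).
Proof. by move=> hA hB u; rewrite mulmxDr mulmxDl mxE addr_ge0. Qed.

Lemma psd0 n : psd (0 : 'M[C]_n).
Proof. by move=> u; rewrite mulmx0 mul0mx mxE. Qed.

Lemma psd_sum n (I : Type) (r : seq I) (Q : pred I) (F : I -> 'M[C]_n) :
  (forall i, Q i -> psd (F i)) -> psd (\sum_(i <- r | Q i) F i).
Proof. by move=> hF; apply: big_ind => //; [exact: psd0 | exact: psdD]. Qed.

Lemma psdZ n c (A : 'M[C]_n) : 0 <= c -> psd A -> psd (c *: A).
Proof. by move=> c0 hA u; rewrite -scalemxAr -scalemxAl mxE mulr_ge0. Qed.

Lemma psd_diag_ge0 n (A : 'M[C]_n) i : psd A -> 0 <= A i i.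
Proof.
by move=> /(_ (delta_mx i 0)); rewrite trmxC_delta -rowE -colE !mxE.
Qed.

Lemma psd_trace_ge0 n (A : 'M[C]_n) : psd A -> 0 <= \tr A.
Proof. by move=> hA; apply: sumr_ge0 => i _; exact: psd_diag_ge0. Qed.

(** The quadratic form of [A] is real, so the functional given by the trace against the adjoint of
    [A] minus [A] vanishes on all rank-one projections, hence everywhere by polarization. *)
Lemma psd_herm n (A : 'M[C]_n) : psd A -> A ^t* = A.
Proof.
move=> hA; apply/eqP; rewrite -subr_eq0; apply/eqP.
pose L := (mxtrace \o mulmx (A ^t* - A) : {linear 'M[C]_n -> C^o}).
have L0 (u : 'cV[C]_n) : L (u *m u ^t*) = 0.
  have := hA u; set z := u ^t* *m A *m u => z0.
  have -> : L (u *m u ^t*) = \tr (z ^t* - z).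
    rewrite /L /= mulmxA mxtrace_mulC /z !trmxC_mul trmxCK.
    by rewrite mulmxA mulmxBr mulmxBl !mulmxA.
  rewrite linearB /= mxtrace_trmxC /mxtrace !big_ord1 geC0_conj ?subrr //.
apply/matrixP => i j; rewrite [RHS]mxE.
have := linear_rank1_eq0 L0 (delta_mx j i).
rewrite /L /= -(mul_delta_mx (0 : 'I_1)) mulmxA mxtrace_mulC /= -colE -rowE.
by rewrite /mxtrace big_ord1 mxE mxE => ->.
Qed.


(** The formula of [sqrtmx] with an arbitrary [f]: square root, pseudo-inverse and support
    projection share one eigenbasis, so their identities reduce to scalar ones on the
    eigenvalues. *)
Definition mxfun (f : C -> C) n (A : 'M[C]_n) : 'M[C]_n :=
  invmx (spectralmx A) *m diag_mx (map_mx f (spectral_diag A)) *m spectralmx A.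

Lemma mxfunM f g n (A : 'M[C]_n) :
  mxfun f A *m mxfun g A = mxfun (fun x => f x * g x) A.
Proof.
rewrite /mxfun -!mulmxA (mulmxA (spectralmx A)) mulmxV ?spectral_unit // mul1mx.
rewrite (mulmxA (diag_mx _)) mulmx_diag; congr (_ *m (diag_mx _ *m _)).
by apply/rowP => j; rewrite !mxE.
Qed.

Lemma psd_mxfun_id n (A : 'M[C]_n) : psd A -> mxfun id A = A.
Proof.
move=> hA; rewrite /mxfun map_mx_id //.
apply/esym/orthomx_spectralP/hermitian_normalmx.
by apply/is_hermitianmxP; rewrite expr0 scale1r psd_herm.
Qed.

Lemma spectral_diag_ge0 n (A : 'M[C]_n) i : psd A -> 0 <= spectral_diag A 0 i.
Proof.
move=> hA; have := psd_mxfun_id hA; rewrite /mxfun map_mx_id // => eA.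
have := psd_conj (invmx (spectralmx A)) hA.
rewrite -{2}eA invmx_unitary ?spectral_unitarymx // trmxCK.
have /unitarymxP VV := spectral_unitarymx A.
rewrite !mulmxA VV mul1mx -mulmxA VV mulmx1 => /(psd_diag_ge0 i).
by rewrite mxE eqxx mulr1n.
Qed.

Lemma eq_mxfun f g n (A : 'M[C]_n) : psd A -> (forall x, 0 <= x -> f x = g x) ->
  mxfun f A = mxfun g A.
Proof.
move=> hA fg; congr (_ *m diag_mx _ *m _); apply/rowP => j; rewrite !mxE.
exact/fg/spectral_diag_ge0.
Qed.

(** [f] applied to [A] is the square of [sqrtC \o f] applied to [A], and this root is Hermitian
    because its eigenvalues are real; so the square is a Gram matrix. *)
Lemma psd_mxfun f n (A : 'M[C]_n) : psd A -> (forall x, 0 <= x -> 0 <= f x) ->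
  psd (mxfun f A).
Proof.
move=> hA f0.
have -> : mxfun f A = mxfun (sqrtC \o f) A *m mxfun (sqrtC \o f) A.
  by rewrite mxfunM; apply: eq_mxfun => // x x0; rewrite /= -expr2 sqrtCK.
rewrite {1}/mxfun invmx_unitary ?spectral_unitarymx //.
set V := spectralmx A; set D := diag_mx _.
have -> : V ^t* *m D *m V = (mxfun (sqrtC \o f) A) ^t*.
  rewrite /mxfun -/V -/D invmx_unitary ?spectral_unitarymx // !trmxC_mul trmxCK.
  rewrite mulmxA /D tr_diag_mx map_diag_mx; congr (_ *m diag_mx _ *m _).
  apply/rowP => j; rewrite !mxE; apply/esym/geC0_conj.
  by rewrite sqrtC_ge0 f0 // spectral_diag_ge0.
exact: psd_gram.
Qed.

Lemma sqrtmxE n (A : 'M[C]_n) : sqrtmx A = mxfun sqrtC A.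
Proof. by []. Qed.

Lemma psd_sqrtmx n (A : 'M[C]_n) : psd A -> psd (sqrtmx A).
Proof. by move=> hA; apply: psd_mxfun => // x; rewrite sqrtC_ge0. Qed.

Lemma sqrtmxK n (A : 'M[C]_n) : psd A -> sqrtmx A *m sqrtmx A = A.
Proof.
move=> hA; rewrite sqrtmxE mxfunM -[RHS]psd_mxfun_id //.
by apply: eq_mxfun => // x _; rewrite -expr2 sqrtCK.
Qed.

(* Moore-Penrose inverse of [sqrtmx A]; it uses [0^-1 = 0]. *)
Definition pinv_sqrtmx n (A : 'M[C]_n) := mxfun (fun x => (sqrtC x)^-1) A.

Lemma psd_pinv_sqrtmx n (A : 'M[C]_n) : psd A -> psd (pinv_sqrtmx A).
Proof. by move=> hA; apply: psd_mxfun => // x; rewrite invr_ge0 sqrtC_ge0. Qed.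

(** For positive [A], the orthogonal projection onto its range: the underlying scalar function is 1
    off zero and 0 at zero. *)
Definition suppmx n (A : 'M[C]_n) := pinv_sqrtmx A *m sqrtmx A.

Lemma suppmxE n (A : 'M[C]_n) : suppmx A = mxfun (fun x => (sqrtC x)^-1 * sqrtC x) A.
Proof. by rewrite /suppmx sqrtmxE mxfunM. Qed.

Lemma suppmxC n (A : 'M[C]_n) : sqrtmx A *m pinv_sqrtmx A = suppmx A.
Proof.
rewrite suppmxE sqrtmxE mxfunM; congr (_ *m diag_mx _ *m _).
by apply/rowP => j; rewrite !mxE mulrC.
Qed.

Lemma psd_suppmx n (A : 'M[C]_n) : psd A -> psd (suppmx A).
Proof.
move=> hA; rewrite suppmxE; apply: psd_mxfun => // x x0.
by rewrite mulr_ge0 ?invr_ge0 ?sqrtC_ge0.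
Qed.

Lemma suppmx_id n (A : 'M[C]_n) : suppmx A *m suppmx A = suppmx A.
Proof.
rewrite !suppmxE mxfunM; congr (_ *m diag_mx _ *m _).
apply/rowP => j; rewrite !mxE; set x := sqrtC _.
by have [->|x0] := eqVneq x 0; rewrite ?mulr0 // mulVf // mulr1.
Qed.

Lemma sqrtmx_supp n (A : 'M[C]_n) : sqrtmx A *m suppmx A = sqrtmx A.
Proof.
rewrite suppmxE sqrtmxE mxfunM; congr (_ *m diag_mx _ *m _).
apply/rowP => j; rewrite !mxE; set x := sqrtC _.
by have [->|x0] := eqVneq x 0; rewrite ?mulr0 ?mul0r // mulVf // mulr1.
Qed.

Lemma psd_supp n (A : 'M[C]_n) : psd A -> A *m suppmx A = A.
Proof. by move=> hA; rewrite -{1}(sqrtmxK hA) -mulmxA sqrtmx_supp sqrtmxK. Qed.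

Lemma psd_pinv_sqrt n (A : 'M[C]_n) : psd A -> A *m pinv_sqrtmx A = sqrtmx A.
Proof.
by move=> hA; rewrite -{1}(sqrtmxK hA) -mulmxA suppmxC sqrtmx_supp.
Qed.

(** With A the Gram matrix of [W] and Q its support, the Gram matrix of W(1 - Q) is (1 - Q)A(1 - Q),
    which is zero. *)
Lemma gram_supp m n (W : 'M[C]_(m, n)) : W *m suppmx (W ^t* *m W) = W.
Proof.
apply/eqP; rewrite -subr_eq0 -[X in _ - X]mulmx1 -mulmxBr; apply/eqP/gram_eq0.
rewrite trmxC_mul -mulmxA (mulmxA (W ^t*)) mulmxBr mulmx1.
by rewrite (psd_supp (psd_gram W)) subrr mulmx0.
Qed.

(** Writing [A] as a Gram matrix of [R] and applying ab <= a^2 + b^2 to each term bounds the entry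
    by the sum of two diagonal entries. The crude factor 2 also covers [i = j]; it only serves to
    bound the feasible set. *)
Lemma psd_entry_le n (A : 'M[C]_n) i j : psd A -> `|A i j| <= 2 * \tr A.
Proof.
move=> hA.
have [R eA] : exists R : 'M[C]_n, A = R ^t* *m R.
  by exists (sqrtmx A); rewrite (psd_herm (psd_sqrtmx hA)) sqrtmxK.
have amgm (a b : C) : 0 <= a -> 0 <= b -> a * b <= a ^+ 2 + b ^+ 2.
  move=> a0 b0; rewrite -subr_ge0 (_ : _ - _ = (a - b) ^+ 2 + a * b); last by ring.
  apply: addr_ge0; last exact: mulr_ge0.
  by rewrite real_exprn_even_ge0 // rpredB ?ger0_real.
have dg l : A l l <= \tr A.
  rewrite /mxtrace (bigD1 l) //= lerDl; apply: sumr_ge0 => k _.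
  exact: psd_diag_ge0.
have dgE l : A l l = \sum_k `|R k l| ^+ 2.
  by rewrite {1}eA mxE; apply: eq_bigr => k _; rewrite !mxE normCKC.
rewrite mulr_natl mulr2n; apply: le_trans (lerD (dg i) (dg j)).
rewrite !dgE -big_split /= {1}eA mxE; apply: le_trans (ler_norm_sum _ _ _) _.
by apply: ler_sum => k _; rewrite !mxE normrM norm_conjC amgm.
Qed.

(* F = A^(1/2), G is the Moore-Penrose inverse of F and Q the projection onto
   the support of A. *)
Record sqrt_spec n (A F G Q : 'M[C]_n) : Prop := SqrtSpec {
  sqrt_herm : F ^t* = F;
  pinv_herm : G ^t* = G;
  supp_herm : Q ^t* = Q;
  sqrt_sq : F *m F = A;
  mul_pinv_sqrt : G *m F = Q;
  mul_sqrt_pinv : F *m G = Q;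
  mul_pinv : A *m G = F;
  supp_idem : Q *m Q = Q;
  sqrt_supp : F *m Q = F;
  gram_mul_supp : forall m (W : 'M[C]_(m, n)), W ^t* *m W = A -> W *m Q = W
}.

(** Packages the calculus so that later proofs can generalize over the roots, inverses and
    projections and forget the spectral formulas. *)
Lemma sqrtmxP n (A : 'M[C]_n) : psd A -> exists G Q, sqrt_spec A (sqrtmx A) G Q.
Proof.
move=> hA; exists (pinv_sqrtmx A), (suppmx A).
split; rewrite ?suppmxC ?suppmx_id ?sqrtmx_supp ?psd_pinv_sqrt ?sqrtmxK //.
- exact/psd_herm/psd_sqrtmx.
- exact/psd_herm/psd_pinv_sqrtmx.
- exact/psd_herm/psd_suppmx.
- by move=> m W <-; exact: gram_supp.
Qed.

End Psd.

(** * Fidelity *)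

Section Fidelity.
Variable C : numClosedFieldType.

Lemma fidelity_attained n (A B : 'M[C]_n) : psd A -> psd B ->
  exists X, psd (block_mx B X (X ^t*) A) /\
            \tr X = \tr (sqrtmx (sqrtmx A *m B *m sqrtmx A)).
Proof.
move=> psdA psdB.
have [_ [_ [hS _ _ SS _ _ _ _ _ _]]] := sqrtmxP psdA.
have [_ [_ [hT _ _ TT _ _ _ _ _ _]]] := sqrtmxP psdB.
move: (sqrtmx A) (sqrtmx B) => S T in hS SS hT TT *.
have : psd (S *m B *m S) by rewrite -{1}hS; exact: psd_conj.
move=> /sqrtmxP [G [Q]]; move: (sqrtmx _) => F [_ hG hQ _ GF _ MG QQ _ _].
have GMG : G *m S *m B *m S *m G = Q.
  by rewrite -GF -MG !mulmxA.
(* With F the root of S B S, the partial isometry of the polar decomposition of T S is T S G;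
   inserting it between T and S gives T T S G S = B S G S. *)
exists (B *m S *m G *m S); split; last first.
  by rewrite mxtrace_mulC -MG !mulmxA.
(* A Gram factorization of the block. The first row alone gives S Q S in the lower right corner; the
   second row adds S (1 - Q) S, and together they make S S = [A]. *)
pose W := block_mx T (T *m S *m G *m S) 0 ((1%:M - Q) *m S).
suff -> : block_mx B (B *m S *m G *m S) ((B *m S *m G *m S) ^t*) A = W ^t* *m W.
  exact: psd_gram.
rewrite /W trmxC_block mulmx_block trmxC0 !mul0mx !mulmx0 !addr0.
rewrite !trmxC_mul hS hT hG trmxCB trmxC1 hQ (psd_herm psdB).
congr block_mx.
- by rewrite TT.
- by rewrite !mulmxA TT.
- by rewrite -!mulmxA TT.
- have -> : S *m (G *m (S *m T)) *m (T *m S *m G *m S) = S *m Q *m S.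
    by rewrite -GMG !mulmxA -(mulmxA _ T T) TT.
  have -> : S *m (1%:M - Q) *m ((1%:M - Q) *m S) = S *m (1%:M - Q) *m S.
    rewrite mulmxA -(mulmxA S) mulmxBr mulmx1 mulmxBl mul1mx QQ.
    by rewrite subrr subr0.
  by rewrite -mulmxDl -mulmxDr addrC subrK mulmx1 SS.
Qed.

(** The block is tested on the column (U, -V). The diagonal terms [t1] and [t2] each contribute the
    trace of F, and the cross terms [t3] and [t4] contribute minus the trace of [X] and minus its
    conjugate. *)
Lemma fidelity_upper n (A B X : 'M[C]_n) : psd (block_mx B X (X ^t*) A) ->
  \tr X + (\tr X)^* <= 2 * \tr (sqrtmx (sqrtmx A *m B *m sqrtmx A)).
Proof.
move=> hX.
(* The two column blocks of the square root of the whole block. They give positivity of [A] and [B],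
   and show that [X] is absorbed by the supports of [B] on the left and [A] on the right. *)
have [R1 [R2 [eB eX eA]]] : exists R1 R2 : 'M[C]_(n + n, n),
    [/\ R1 ^t* *m R1 = B, R1 ^t* *m R2 = X & R2 ^t* *m R2 = A].
  have [_ [_ [hR _ _ RR _ _ _ _ _ _]]] := sqrtmxP hX.
  move: (sqrtmx _) => R in hR RR.
  exists (lsubmx R), (rsubmx R).
  move: RR; rewrite -{1}hR -[R]hsubmxK; move: (lsubmx R) (rsubmx R) => R1 R2.
  rewrite row_mxKl row_mxKr tr_row_mx map_col_mx mul_col_row.
  by move=> /eq_block_mx [].
have psdA : psd A by rewrite -eA; exact: psd_gram.
have psdB : psd B by rewrite -eB; exact: psd_gram.
have [GA [PA [hS hGA hPA SS GAS SGA _ PAPA SPA gramA]]] := sqrtmxP psdA.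
have [GB [PB [hT hGB hPB TT GBT TGB _ PBPB TPB gramB]]] := sqrtmxP psdB.
have XA : X *m PA = X by rewrite -eX -mulmxA gramA.
have BX : PB *m X = X by rewrite -eX -{1}hPB mulmxA -trmxC_mul gramB.
move: (sqrtmx A) (sqrtmx B) => S T in hS SS GAS SGA SPA hT TT GBT TGB TPB *.
have psdM : psd (S *m B *m S) by rewrite -{1}hS; exact: psd_conj.
have [G [Q [_ hG hQ FF GF FG MG _ FQ gramM]]] := sqrtmxP psdM.
(* The Gram matrix of T S is S B S, so its support Q acts trivially. *)
have QST : Q *m S *m T = S *m T.
  have : T *m S *m Q = T *m S.
    by apply: gramM; rewrite trmxC_mul hS hT mulmxA -(mulmxA S) TT.
  by move=> E; rewrite -{2}hS -{2}hT -trmxC_mul -E !trmxC_mul hS hT hQ mulmxA.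
have /sqrtmxP [_ [_ [hN _ _ NN _ _ _ _ _ _]]] := psd_sqrtmx psdM.
move: (sqrtmx (sqrtmx _)) => N in hN NN.
move: (sqrtmx _) => F in FF GF FG MG FQ NN *.
(* [N] is the root of [F], and [T *m S *m G] is the partial isometry of the polar decomposition of T
   S. *)
pose U := GB *m T *m S *m G *m N; pose V := GA *m N.
have eU : U ^t* = N *m G *m S *m T *m GB.
  by rewrite !trmxC_mul hN hG hS hT hGB !mulmxA.
have eV : V ^t* = N *m GA by rewrite trmxC_mul hN hGA.
have t1 : \tr (U ^t* *m B *m U) = \tr F.
  have -> : U ^t* *m B *m U = N *m Q *m N.
    have PBP : PB *m B *m PB = B.
      by rewrite -TT -mulmxA -mulmxA TPB mulmxA -{1}hPB -{1}hT -trmxC_mul TPB hT.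
    have -> : U ^t* *m B *m U =
        N *m G *m S *m ((T *m GB) *m B *m (GB *m T)) *m S *m G *m N.
      by rewrite eU /U !mulmxA.
    by rewrite TGB GBT PBP -GF -MG !mulmxA.
  by rewrite -mulmxA mxtrace_mulC -mulmxA NN mxtrace_mulC FQ.
have t2 : \tr (V ^t* *m A *m V) = \tr F.
  have -> : V ^t* *m A *m V = N *m (PA *m N).
    by rewrite eV /V -PAPA -{1}GAS -SGA -SS !mulmxA.
  rewrite mxtrace_mulC -mulmxA NN -MG !mulmxA.
  by rewrite -{1}hS -{1}hPA -trmxC_mul SPA hS.
(* Cycling the trace joins the two copies of [N] into [F]; then [F G] becomes Q, [T GB] becomes [PB]
   and [GA S] becomes [PA], all of which are absorbed. *)
have t3 : \tr (U ^t* *m X *m V) = \tr X.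
  have -> : U ^t* *m X *m V = N *m (G *m S *m T *m GB *m X *m GA *m N).
    by rewrite eU /V !mulmxA.
  rewrite mxtrace_mulC -(mulmxA _ N N) NN mxtrace_mulC !mulmxA FG QST -(mulmxA S) TGB.
  by rewrite -(mulmxA S) BX mxtrace_mulC mulmxA GAS mxtrace_mulC XA.
have t4 : \tr (V ^t* *m X ^t* *m U) = (\tr X)^*.
  by clearbody U V; rewrite -t3 -mxtrace_trmxC !trmxC_mul trmxCK mulmxA.
have := psd_trace_ge0 (psd_conj (col_mx U (- V)) hX).
rewrite trmxC_col mul_row_block mul_row_col trmxCN !mulNmx !mulmxN.
rewrite !mulmxBl linearB /= linearB /= linearB /= t1 t2 t3 t4 => le0.
by rewrite -subr_ge0 (_ : _ - _ = \tr F - (\tr X)^* - (\tr X - \tr F)) //; ring.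
Qed.

End Fidelity.

(** * Choi matrices *)

Section Choi.
Variable C : numClosedFieldType.

Lemma embed_linear d k : linear (@embed C d k).
Proof.
move=> a X Y; rewrite /embed scale_block_mx add_block_mx.
by rewrite !scaler0 !addr0.
Qed.
HB.instance Definition _ d k := GRing.isLinear.Build C 'M[C]_d 'M[C]_(d + k)
  *:%R (@embed C d k) (@embed_linear d k).

Lemma block_dephasing_linear d n (P : 'I_n -> 'M[C]_d) :
  linear (block_dephasing P).
Proof.
move=> a X Y; rewrite /block_dephasing scaler_sumr -big_split /=.
apply: eq_bigr => i _.
by rewrite mulmxDr mulmxDl -scalemxAr -scalemxAl.
Qed.
HB.instance Definition _ d n (P : 'I_n -> 'M[C]_d) :=
  GRing.isLinear.Build C 'M[C]_d 'M[C]_d *:%R (block_dephasing P)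
    (block_dephasing_linear P).

Lemma subspace_compression_linear d k : linear (@subspace_compression C d k).
Proof.
move=> a X Y; rewrite /subspace_compression.
by rewrite mulmxDr mulmxDl -scalemxAr -scalemxAl.
Qed.
HB.instance Definition _ d k :=
  GRing.isLinear.Build C 'M[C]_(d + k) 'M[C]_(d + k) *:%R
    (@subspace_compression C d k) (@subspace_compression_linear d k).

Lemma vec_linear n : linear (@vec C n).
Proof. by move=> a X Y; apply/matrixP => i j; rewrite !mxE. Qed.
HB.instance Definition _ n :=
  GRing.isLinear.Build C 'M[C]_n 'cV[C]_(n * n) *:%R (@vec C n) (@vec_linear n).

Lemma unvec_linear n : linear (@unvec C n).
Proof. by move=> a X Y; apply/matrixP => i j; rewrite !mxE. Qed.
HB.instance Definition _ n :=
  GRing.isLinear.Build C 'cV[C]_(n * n) 'M[C]_n *:%R (@unvec C n)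
    (@unvec_linear n).

Lemma vecK n : cancel (@vec C n) (@unvec C n).
Proof. by move=> Y; apply/matrixP => i j; rewrite !mxE mxtens_indexK. Qed.

Lemma unvecK n : cancel (@unvec C n) (@vec C n).
Proof.
move=> v; apply/colP => a; rewrite !mxE /=.
by rewrite -[RHS](congr1 (v ^~ 0) (mxtens_unindexK a)); congr (v (mxtens_index _) _).
Qed.

Lemma sum_tens m n (V : nmodType) (F : 'I_(m * n) -> V) :
  \sum_a F a = \sum_i \sum_j F (mxtens_index (i, j)).
Proof.
rewrite pair_big /= (reindex (@mxtens_index m n)) /=; last first.
  by exists (@mxtens_unindex m n) => a _; rewrite ?mxtens_indexK ?mxtens_unindexK.
by apply: eq_bigr => -[].
Qed.

Lemma tens_matrixP m n m' n' (X Y : 'M[C]_(m * n, m' * n')) :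
  (forall a b c e, X (mxtens_index (a, b)) (mxtens_index (c, e)) =
                   Y (mxtens_index (a, b)) (mxtens_index (c, e))) -> X = Y.
Proof.
move=> XY; apply/matrixP => p q.
by case: (mxtens_indexP p) (mxtens_indexP q) => a b [c e]; exact: XY.
Qed.

Lemma mxtrace_delta n (Y : 'M[C]_n) i j : \tr (delta_mx i j *m Y) = Y j i.
Proof.
rewrite -(mul_delta_mx (0 : 'I_1)) -mulmxA mxtrace_mulC -mulmxA -colE.
by rewrite -rowE /mxtrace big_ord1 !mxE.
Qed.

Lemma map_matrixE m n (Phi : 'M[C]_m -> 'M[C]_n) a b i j :
  map_matrix Phi (mxtens_index (a, b)) (mxtens_index (i, j)) =
  Phi (delta_mx i j) a b.
Proof.
rewrite mxE /matrix_unit !mxtens_indexK /=.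
by rewrite trmxC_delta mxtrace_delta.
Qed.

Lemma linear_mx_entry m n (Phi : {linear 'M[C]_m -> 'M[C]_n}) Y a b :
  Phi Y a b = \sum_i \sum_j Y i j * Phi (delta_mx i j) a b.
Proof.
rewrite {1}(matrix_sum_delta Y) linear_sum summxE; apply: eq_bigr => i _.
by rewrite linear_sum summxE; apply: eq_bigr => j _; rewrite linearZ mxE.
Qed.

Lemma map_matrix_vec m n (Phi : {linear 'M[C]_m -> 'M[C]_n}) Y :
  map_matrix Phi *m vec Y = vec (Phi Y).
Proof.
apply/colP => p; case: (mxtens_indexP p) => a b; rewrite mxE.
rewrite sum_tens [RHS]mxE !mxtens_indexK /= linear_mx_entry.
apply: eq_bigr => i _; apply: eq_bigr => j _.
by rewrite map_matrixE mxE mxtens_indexK mulrC.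
Qed.

Lemma eq_mulmx_vec n p (M N : 'M[C]_(p, n * n)) :
  (forall Y, M *m vec Y = N *m vec Y) -> M = N.
Proof.
move=> MN; apply/matrixP => i q.
have := congr1 (fun v : 'cV_p => v i 0) (MN (unvec (delta_mx q 0))).
by rewrite unvecK -!colE !mxE.
Qed.

(** Mostly rewritten from right to left: it expands an entry into a sum over a tensor index, so that
    two double sums can be compared term by term. *)
Lemma sum_indic (I : finType) (f : I -> C) a : \sum_l (l == a)%:R * f l = f a.
Proof.
rewrite (bigD1 a) //= eqxx mul1r big1 ?addr0 // => l /negPf ->.
by rewrite mul0r.
Qed.

Lemma tens_mul_1delta n m p q a b y (X : 'M[C]_(n * n, m)) :
  (tensmx 1%:M (delta_mx p q : 'M_n) *m X) (mxtens_index (a, b)) y =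
  (b == p)%:R * X (mxtens_index (a, q)) y.
Proof.
rewrite mxE sum_tens -[X in _ * X](sum_indic (fun l => X (mxtens_index (l, q)) y)).
rewrite mulr_sumr; apply: eq_bigr => l _.
rewrite -[X in _ * (_ * X)](sum_indic (fun l' => X (mxtens_index (l, l')) y)).
rewrite !mulr_sumr; apply: eq_bigr => l' _.
by rewrite tensmxE !mxE eq_sym; do 3?case: eqP => _; rewrite /= ?mulr0n ?mulr1n; ring.
Qed.

Lemma tens_mul_delta1 n m p q x i j (X : 'M[C]_(m, n * n)) :
  (X *m tensmx (delta_mx p q : 'M_n) 1%:M) x (mxtens_index (i, j)) =
  (i == q)%:R * X x (mxtens_index (p, j)).
Proof.
rewrite mxE sum_tens -[X in _ * X](sum_indic (fun l => X x (mxtens_index (l, j)))).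
rewrite mulr_sumr; apply: eq_bigr => l _.
rewrite -[X in _ * (_ * X)](sum_indic (fun l' => X x (mxtens_index (l, l')))).
rewrite !mulr_sumr; apply: eq_bigr => l' _.
by rewrite tensmxE !mxE; do 3?case: eqP => _; rewrite /= ?mulr0n ?mulr1n; ring.
Qed.

Lemma reshuffleE n (X : 'M[C]_(n * n)) a b i j :
  reshuffle X (mxtens_index (a, b)) (mxtens_index (i, j)) =
  X (mxtens_index (a, i)) (mxtens_index (b, j)).
Proof.
rewrite /reshuffle summxE sum_tens.
rewrite -(sum_indic (fun p => X (mxtens_index (a, i)) (mxtens_index (p, j)))).
apply: eq_bigr => p _.
rewrite -(sum_indic (fun q => X (mxtens_index (a, q)) (mxtens_index (p, j)))).
rewrite mulr_sumr; apply: eq_bigr => q _.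
rewrite /matrix_unit mxtens_indexK /= tens_mul_delta1 tens_mul_1delta.
by rewrite (eq_sym b) (eq_sym i); ring.
Qed.

(* The map whose normalised Choi matrix is J. *)
Definition choi_map n (J : 'M[C]_(n * n)) (Y : 'M[C]_n) : 'M[C]_n :=
  unvec (n%:R *: (reshuffle J *m vec Y)).

Lemma choi_map_linear n (J : 'M[C]_(n * n)) : linear (choi_map J).
Proof.
move=> a X Y; rewrite /choi_map linearP /= mulmxDr -scalemxAr scalerDr.
by rewrite scalerA mulrC -scalerA linearP.
Qed.
HB.instance Definition _ n (J : 'M[C]_(n * n)) :=
  GRing.isLinear.Build C 'M[C]_n 'M[C]_n *:%R (choi_map J) (choi_map_linear J).

Lemma vec_choi_map n (J : 'M[C]_(n * n)) Y :
  vec (choi_map J Y) = n%:R *: (reshuffle J *m vec Y).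
Proof. exact: unvecK. Qed.

Lemma choi_mapE n (J : 'M[C]_(n * n)) Y a b :
  choi_map J Y a b =
  n%:R * \sum_i \sum_j J (mxtens_index (a, i)) (mxtens_index (b, j)) * Y i j.
Proof.
rewrite !mxE; congr (_ * _); rewrite sum_tens.
apply: eq_bigr => i _; apply: eq_bigr => j _.
by rewrite reshuffleE mxE mxtens_indexK.
Qed.

Definition choi n (Phi : 'M[C]_n -> 'M[C]_n) : 'M[C]_(n * n) :=
  \matrix_(p, q) (n%:R^-1 *
    Phi (delta_mx (mxtens_unindex p).2 (mxtens_unindex q).2)
      (mxtens_unindex p).1 (mxtens_unindex q).1).

Lemma choiE n (Phi : 'M[C]_n -> 'M[C]_n) a i b j :
  choi Phi (mxtens_index (a, i)) (mxtens_index (b, j)) =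
  n%:R^-1 * Phi (delta_mx i j) a b.
Proof. by rewrite mxE !mxtens_indexK. Qed.

(** Entrywise arguments supply such an index, so the normalisation of the Choi matrix cancels
    without assuming a positive dimension. *)
Lemma dim_neq0 n : 'I_n -> n%:R != 0 :> C.
Proof. by case: n => [[]//|n] _; rewrite pnatr_eq0. Qed.

Lemma choiK n (Phi : {linear 'M[C]_n -> 'M[C]_n}) : choi_map (choi Phi) =1 Phi.
Proof.
move=> Y; apply/matrixP => a b; rewrite choi_mapE linear_mx_entry mulr_sumr.
apply: eq_bigr => i _; rewrite mulr_sumr; apply: eq_bigr => j _.
by rewrite choiE !mulrA mulfV ?dim_neq0 // mul1r mulrC.
Qed.

Lemma choi_mapK n (J : 'M[C]_(n * n)) : choi (choi_map J) = J.
Proof.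
apply: tens_matrixP => a i b j; rewrite choiE choi_mapE mulrA mulVf ?dim_neq0 //.
rewrite mul1r.
rewrite -[RHS](sum_indic (fun l => J (mxtens_index (a, l)) (mxtens_index (b, j)))).
apply: eq_bigr => l _.
rewrite -[X in _ = _ * X](sum_indic
  (fun l' => J (mxtens_index (a, l)) (mxtens_index (b, l')))).
rewrite mulr_sumr; apply: eq_bigr => l' _.
by rewrite !mxE; do 2?case: eqP => _; rewrite /= ?mulr0n ?mulr1n; ring.
Qed.

Lemma ampliationE m n (Phi : 'M[C]_m -> 'M[C]_n) r (X : 'M[C]_(m * r)) a i b j :
  ampliation Phi X (mxtens_index (a, i)) (mxtens_index (b, j)) =
  Phi (\matrix_(a', b') X (mxtens_index (a', i)) (mxtens_index (b', j))) a b.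
Proof.
pose Y i' j' := Phi (\matrix_(a', b')
  X (mxtens_index (a', i')) (mxtens_index (b', j'))) a b.
rewrite -/(Y i j) -(sum_indic (Y ^~ j)) summxE; apply: eq_bigr => i' _.
rewrite -(sum_indic (Y i')) mulr_sumr summxE; apply: eq_bigr => j' _.
rewrite tensmxE -/(Y i' j') mxE (eq_sym i) (eq_sym j) -mulnb natrM.
by ring.
Qed.

Lemma tens_mul_id m m' n p (K : 'M[C]_(m, m')) (X : 'M[C]_(m' * n, p)) a i y :
  (tensmx K 1%:M *m X) (mxtens_index (a, i)) y =
  \sum_l K a l * X (mxtens_index (l, i)) y.
Proof.
rewrite mxE sum_tens; apply: eq_bigr => l _.
rewrite -[X in _ * X](sum_indic (fun l' => X (mxtens_index (l, l')) y)) mulr_sumr.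
apply: eq_bigr => l' _; rewrite tensmxE mxE eq_sym.
by ring.
Qed.

(** A Kraus form makes the ampliation a sum of conjugations by K (x) 1, which visibly preserve
    positivity. *)
Lemma ampliation_kraus m n r (I : finType) c (K : I -> 'M[C]_(n, m))
    (Phi : 'M[C]_m -> 'M[C]_n) :
  (forall Y, Phi Y = c *: \sum_l K l *m Y *m (K l) ^t*) ->
  forall X : 'M[C]_(m * r), ampliation Phi X =
    c *: \sum_l (tensmx (K l) 1%:M) *m X *m (tensmx (K l) 1%:M) ^t*.
Proof.
move=> PhiE X; apply: tens_matrixP => a i b j; rewrite ampliationE PhiE !mxE.
rewrite !summxE; congr (_ * _); apply: eq_bigr => l _.
set Z := tensmx (K l) 1%:M *m X.
(* Passing to the adjoint turns the right factor into a left one, so [tens_mul_id] handles both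
   sides. *)
have -> : (Z *m (tensmx (K l) 1%:M) ^t*) (mxtens_index (a, i)) (mxtens_index (b, j))
  = ((tensmx (K l) 1%:M *m Z ^t*) (mxtens_index (b, j)) (mxtens_index (a, i)))^*.
  by rewrite -{1}[Z]trmxCK -trmxC_mul mxE mxE.
rewrite tens_mul_id rmorph_sum mxE; apply: eq_bigr => b' _.
rewrite rmorphM /= mulrC; congr (_ * _); first by rewrite !mxE.
rewrite [in RHS]mxE [in RHS]mxE conjCK /Z tens_mul_id mxE.
by apply: eq_bigr => a' _; rewrite mxE.
Qed.

(** The columns of the square root of [J], reshaped into matrices, are the Kraus operators. *)
Lemma choi_map_kraus n (J : 'M[C]_(n * n)) : psd J ->
  exists K : 'I_(n * n) -> 'M[C]_n,
    forall Y, choi_map J Y = n%:R *: \sum_l K l *m Y *m (K l) ^t*.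
Proof.
move=> /sqrtmxP [_ [_ [hR _ _ RR _ _ _ _ _ _]]].
move: (sqrtmx J) => R in hR RR.
exists (fun l => \matrix_(a, i) R (mxtens_index (a, i)) l) => Y.
apply/matrixP => a b; rewrite choi_mapE mxE summxE; congr (_ * _).
transitivity (\sum_i \sum_j \sum_l
    R (mxtens_index (a, i)) l * Y i j * (R (mxtens_index (b, j)) l)^*).
  apply: eq_bigr => i _; apply: eq_bigr => j _.
  rewrite -RR mxE mulr_suml; apply: eq_bigr => l _.
  by rewrite -{2}hR !mxE; ring.
under eq_bigr do rewrite exchange_big /=.
rewrite exchange_big /=; apply: eq_bigr => l _.
rewrite mxE exchange_big /=; apply: eq_bigr => j _.
rewrite !mxE mulr_suml; apply: eq_bigr => i _.
by rewrite !mxE.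
Qed.

Lemma choi_map_cp n (J : 'M[C]_(n * n)) : psd J -> completely_positive (choi_map J).
Proof.
move=> /choi_map_kraus [K KE] r X hX; rewrite (ampliation_kraus KE).
apply: psdZ; first exact: ler0n.
by apply: psd_sum => l _; rewrite -{1}[tensmx _ _]trmxCK; exact: psd_conj.
Qed.

Lemma choi_map_psd n (J : 'M[C]_(n * n)) Y : psd J -> psd Y -> psd (choi_map J Y).
Proof.
move=> /choi_map_kraus [K KE] hY; rewrite KE.
apply: psdZ; first exact: ler0n.
by apply: psd_sum => l _; rewrite -{1}[K l]trmxCK; exact: psd_conj.
Qed.

(** The Choi matrix is, up to the positive factor 1/n, the ampliation evaluated at the rank-one
    matrix of the unnormalised maximally entangled vector [vec 1%:M]. *)
Lemma cp_choi n (Phi : 'M[C]_n -> 'M[C]_n) : completely_positive Phi -> psd (choi Phi).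
Proof.
move=> cpPhi; pose v : 'cV[C]_(n * n) := vec 1%:M.
have -> : choi Phi = n%:R^-1 *: ampliation Phi (v *m v ^t*).
  apply: tens_matrixP => a i b j; rewrite choiE mxE ampliationE.
  congr (_ * Phi _ _ _); apply/matrixP => a' b'.
  rewrite [RHS]mxE [RHS]mxE big_ord1 !mxE !mxtens_indexK /=.
  by rewrite rmorph_nat -natrM mulnb.
apply: psdZ; first by rewrite invr_ge0 ler0n.
by apply: cpPhi; rewrite -{1}[v]trmxCK; exact: psd_gram.
Qed.

Lemma trace_choi_map n (J : 'M[C]_(n * n)) Y :
  \tr (choi_map J Y) = n%:R * \sum_i \sum_j partial_trace1 J i j * Y i j.
Proof.
rewrite /mxtrace; under eq_bigr do rewrite choi_mapE.
rewrite -mulr_sumr; congr (_ * _); rewrite exchange_big /=.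
apply: eq_bigr => i _; rewrite exchange_big /=; apply: eq_bigr => j _.
by rewrite mxE mulr_suml.
Qed.

Lemma trace_preserving_choi_map n (J : 'M[C]_(n * n)) :
  (forall Y, \tr (choi_map J Y) = \tr Y) <-> partial_trace1 J = (n%:R^-1)%:M.
Proof.
split=> [tp|ptJ Y]; last first.
  rewrite trace_choi_map ptJ mulr_sumr; apply: eq_bigr => i _.
  rewrite -[RHS](sum_indic (Y i)) mulr_sumr; apply: eq_bigr => j _.
  rewrite mxE eq_sym -[n%:R^-1 *+ _]mulr_natr !mulrA mulfV ?mul1r //.
  exact: dim_neq0.
apply/matrixP => i j; have := tp (delta_mx i j).
rewrite trace_choi_map -[delta_mx i j in RHS]mulmx1 mxtrace_delta.
rewrite (_ : \sum_i0 _ = partial_trace1 J i j) => [E|]; last first.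
  rewrite -[RHS](sum_indic (fun l => partial_trace1 J l j)).
  apply: eq_bigr => l _.
  rewrite -[X in _ = _ * X](sum_indic (partial_trace1 J l)).
  rewrite mulr_sumr; apply: eq_bigr => l' _.
  rewrite [X in _ * X = _]mxE -mulnb natrM; ring.
apply: (mulfI (dim_neq0 i)); rewrite E !mxE eq_sym -[_^-1 *+ _]mulr_natr mulrA.
by rewrite mulfV ?mul1r // dim_neq0.
Qed.

Lemma channel_choi_map n (J : 'M[C]_(n * n)) :
  channel (choi_map J) <-> psd J /\ partial_trace1 J = (n%:R^-1)%:M.
Proof.
split=> [[_ cp tp]|[psdJ ptJ]].
  by split; [rewrite -[J]choi_mapK; exact: cp_choi | exact/trace_preserving_choi_map].
split; [exact: choi_map_linear | exact: choi_map_cp | exact/trace_preserving_choi_map].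
Qed.

(** Replaces an arbitrary channel by a [choi_map], which carries the linear structure that a bare
    function lacks. *)
Lemma channel_ex_choi n (Phi : 'M[C]_n -> 'M[C]_n) : channel Phi ->
  exists J : 'M[C]_(n * n), choi_map J = Phi.
Proof.
move=> [linPhi _ _].
pose L : {linear 'M[C]_n -> 'M[C]_n} :=
  HB.pack Phi (GRing.isLinear.Build _ _ _ _ Phi linPhi).
by exists (choi L); apply/funext => Y; rewrite choiK.
Qed.

(** Products of matrices represent compositions of maps, and [vec] is a bijection; only the common
    factor n has to be cancelled. *)
Lemma intertwine_choi_map n (J : 'M[C]_(n * n)) (Psi : {linear 'M[C]_n -> 'M[C]_n}) :
  reshuffle J *m map_matrix Psi = map_matrix Psi *m reshuffle J *m map_matrix Psi
  <-> forall Y, choi_map J (Psi Y) = Psi (choi_map J (Psi Y)).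
Proof.
split=> [E Y|E].
  apply: (can_inj (@vecK n)); rewrite -map_matrix_vec vec_choi_map.
  by rewrite -map_matrix_vec -scalemxAr !mulmxA E.
apply: eq_mulmx_vec => Y; have := congr1 (@vec C n) (E Y).
rewrite -map_matrix_vec vec_choi_map -map_matrix_vec -scalemxAr !mulmxA.
(* For n = 0 the factor cannot be cancelled, but the vectors are empty. *)
case: n => [|n] in J Psi Y E *; first by move=> _; apply/colP => -[].
by apply: scalerI; rewrite pnatr_eq0.
Qed.

End Choi.

(** * States, dephasing and embedding *)

Section States.
Variable C : numClosedFieldType.

(** States span all matrices: a nonzero rank-one positive matrix is its trace times a state, and
    polarization does the rest. *)
Lemma linear_density_eq0 n (V : lmodType C) (L : {linear 'M[C]_n -> V}) :
  (forall rho, density rho -> L rho = 0) -> forall Y, L Y = 0.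
Proof.
move=> L0; apply: linear_rank1_eq0 => u.
have psdu : psd (u *m u ^t*) by rewrite -{1}[u]trmxCK; exact: psd_gram.
have [t0|tn0] := eqVneq (\tr (u *m u ^t*)) 0.
  have -> : u = 0; last by rewrite mul0mx linear0.
  have uu0 : \tr ((u ^t*) *m u) = 0 by rewrite mxtrace_mulC.
  apply: gram_eq0; apply/matrixP => i j; rewrite !ord1 [RHS]mxE -uu0.
  by rewrite /mxtrace big_ord1.
rewrite -[u *m _]scale1r -(mulfV tn0) -scalerA linearZ /= L0 ?scaler0 //.
split; last by rewrite mxtraceZ mulVf.
by apply: psdZ => //; rewrite invr_ge0 psd_trace_ge0.
Qed.

Lemma linear_density_eq n (V : lmodType C) (L L' : {linear 'M[C]_n -> V}) :
  (forall rho, density rho -> L rho = L' rho) -> L =1 L'.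
Proof.
move=> LL' Y; apply/eqP; rewrite -subr_eq0; apply/eqP.
apply: (@linear_density_eq0 _ _ (L \- L')) => rho hrho /=.
by rewrite LL' ?subrr.
Qed.

Section Dephasing.
Variables (d n : nat) (P : 'I_n -> 'M[C]_d).
Hypothesis projP : projective_measurement P.

Lemma block_dephasing_idem X :
  block_dephasing P (block_dephasing P X) = block_dephasing P X.
Proof.
case: projP => _ PP; apply: eq_bigr => i _.
rewrite /block_dephasing mulmx_sumr mulmx_suml (bigD1 i) //= big1 ?addr0.
  by rewrite !mulmxA PP eqxx -[LHS]mulmxA PP eqxx.
by move=> j /negPf nj; rewrite !mulmxA PP eq_sym nj !mul0mx.
Qed.

Lemma density_block_dephasing X : density X -> density (block_dephasing P X).
Proof.
case: projP => -[psdP sumP] PP [psdX trX]; split.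
  by apply: psd_sum => i _; rewrite -{1}(psd_herm (psdP i)); exact: psd_conj.
rewrite /block_dephasing linear_sum /= -trX -[in RHS](mul1mx X) -sumP.
rewrite mulmx_suml linear_sum /=; apply: eq_bigr => i _.
by rewrite mxtrace_mulC mulmxA PP eqxx.
Qed.

(** An image of dephasing is fixed by dephasing, which is idempotent; this gives the equation on
    states, and linearity extends it. Conversely the equation exhibits the image state as a dephased
    state. *)
Lemma block_incoherentP (Phi : {linear 'M[C]_d -> 'M[C]_d}) :
  (forall rho, density rho -> density (Phi rho)) ->
  block_incoherent P Phi <->
  forall X, Phi (block_dephasing P X) = block_dephasing P (Phi (block_dephasing P X)).
Proof.
move=> dPhi; split=> [inc|E].
  apply: (linear_density_eq (L := Phi \o block_dephasing P)
    (L' := block_dephasing P \o (Phi \o block_dephasing P))) => rho hrho /=.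
  have [|tau _ <-] := inc (Phi (block_dephasing P rho)).
    by exists (block_dephasing P rho) => //; exists rho.
  by rewrite block_dephasing_idem.
move=> _ [_ [rho hrho <-] <-]; exists (Phi (block_dephasing P rho)); last by rewrite -E.
exact/dPhi/density_block_dephasing.
Qed.

End Dephasing.

Section Embedding.
Variables d k : nat.

Lemma embedK : cancel (@embed C d k) (@unembed C d k).
Proof. by move=> X; rewrite /unembed block_mxKul. Qed.

Lemma subspace_compressionE (X : 'M[C]_(d + k)) :
  subspace_compression X = embed k (unembed X).
Proof.
rewrite /subspace_compression /subspace_proj /embed /unembed -{1}[X]submxK.
by rewrite !mulmx_block !mul0mx !mulmx0 ?mul1mx ?mulmx1 !addr0.
Qed.

Lemma mxtrace_embed X : \tr (@embed C d k X) = \tr X.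
Proof. by rewrite mxtrace_block mxtrace0 addr0. Qed.

Lemma psd_embed X : psd X -> psd (@embed C d k X).
Proof.
move=> psdX; suff -> : embed k X =
    (row_mx 1%:M 0 : 'M[C]_(d, d + k)) ^t* *m X *m row_mx 1%:M 0.
  exact: psd_conj.
rewrite tr_row_mx map_col_mx trmxC1 trmxC0 mul_col_mx mul_col_row.
by rewrite !mul0mx !mulmx0 mul1mx mulmx1.
Qed.

Lemma density_embed X : density X -> density (@embed C d k X).
Proof. by move=> [psdX trX]; split; [exact: psd_embed|rewrite mxtrace_embed]. Qed.

Lemma psd_unembed (Y : 'M[C]_(d + k)) : psd Y -> psd (unembed Y).
Proof.
move=> psdY; suff -> : unembed Y =
    (col_mx 1%:M 0 : 'M[C]_(d + k, d)) ^t* *m Y *m col_mx 1%:M 0.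
  exact: psd_conj.
rewrite trmxC_col trmxC1 trmxC0 -{2}[Y]submxK mul_row_block mul_row_col.
by rewrite !mul0mx !mulmx0 mul1mx mulmx1 !addr0.
Qed.

(** The compression is [embed] after [unembed], so its fixed points are the embedded matrices. In
    the converse direction the equation also shows that [unembed] loses no trace. *)
Lemma subspace_preservingP (Phi : {linear 'M[C]_(d + k) -> 'M[C]_(d + k)}) :
  (forall rho, density rho -> density (Phi rho)) ->
  subspace_preserving Phi <->
  forall X, Phi (subspace_compression X) =
            subspace_compression (Phi (subspace_compression X)).
Proof.
move=> dPhi; split=> [pres X|E].
  rewrite (subspace_compressionE X).
  apply: (linear_density_eq (L := Phi \o @embed C d k)
    (L' := @subspace_compression C d k \o (Phi \o @embed C d k))) => rho hrho /=.
  have [|tau _ <-] := pres (Phi (embed k rho)).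
    by exists (embed k rho) => //; exists rho.
  by rewrite subspace_compressionE embedK.
move=> _ [_ [rho hrho <-] <-].
have := E (embed k rho); rewrite !subspace_compressionE !embedK => Erho.
have [psdY trY] := dPhi _ (density_embed hrho).
exists (unembed (Phi (embed k rho))) => //.
by split; [exact: psd_unembed|rewrite -trY Erho mxtrace_embed embedK].
Qed.

Lemma embed_delta i j :
  embed k (delta_mx i j : 'M[C]_d) = delta_mx (lshift k i) (lshift k j).
Proof.
apply/matrixP => a b; rewrite /embed; case: (split_ordP a) => a' ->;
  case: (split_ordP b) => b' ->;
  by rewrite ?block_mxEul ?block_mxEur ?block_mxEdl ?block_mxEdr !mxE
    ?eq_lshift ?eq_rlshift ?andbF.
Qed.

(** [embed] sends matrix units to matrix units, so its adjoint selects the entries of the upper left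
    block. *)
Lemma adj_embed_vec (Y : 'M[C]_(d + k)) :
  (map_matrix (@embed C d k)) ^t* *m vec Y = vec (unembed Y).
Proof.
apply/colP => p; case: (mxtens_indexP p) => i j; rewrite mxE sum_tens.
rewrite [RHS]mxE mxtens_indexK /= /unembed !mxE.
rewrite -(sum_indic (fun a => Y a (lshift k j))); apply: eq_bigr => a _.
rewrite -[X in _ = _ * X](sum_indic (Y a)) mulr_sumr; apply: eq_bigr => b _.
rewrite mxE [X in X^* * _]mxE map_matrixE embed_delta mxE rmorph_nat.
by rewrite mxE mxtens_indexK /= -mulnb natrM mulrA.
Qed.

Lemma sdp_outputE (J : 'M[C]_((d + k) * (d + k))) rho :
  sdp_output J rho = unembed (choi_map J (embed k rho)).
Proof.
apply: (can_inj (@vecK C d)); rewrite -adj_embed_vec vec_choi_map unvecK.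
by rewrite -map_matrix_vec -scalemxAr !mulmxA.
Qed.

(** Positivity is read off the Kraus form of the Choi matrix, which avoids identifying dimension
    [n * 1] with [n]. *)
Lemma channel_density n (Phi : 'M[C]_n -> 'M[C]_n) rho :
  channel Phi -> density rho -> density (Phi rho).
Proof.
move=> chPhi [psdrho trrho]; have [_ _ tp] := chPhi.
have [J eJ] := channel_ex_choi chPhi.
split; last by rewrite tp.
move: chPhi; rewrite -eJ => /channel_choi_map [psdJ _].
exact: choi_map_psd.
Qed.

(** The matrix constraints are suited to compactness; this form is suited to the comparison with
    operations. *)
Lemma sdp_feasibleP n (P : 'I_n -> 'M[C]_(d + k)) rho sigma X
    (J : 'M[C]_((d + k) * (d + k))) : projective_measurement P ->
  sdp_feasible P rho sigma X J <->
  [/\ psd (block_mx sigma X (X ^t*) (unembed (choi_map J (embed k rho)))),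
      channel (choi_map J), block_incoherent P (choi_map J) &
      subspace_preserving (choi_map J)].
Proof.
move=> projP; rewrite /sdp_feasible /= sdp_outputE; split.
  move=> [psdX psdJ ptJ inc pres].
  have chJ : channel (choi_map J) by apply/channel_choi_map.
  split=> //.
    apply/(block_incoherentP projP) => [?|]; first exact: channel_density.
    exact/intertwine_choi_map.
  apply/subspace_preservingP => [?|]; first exact: channel_density.
  exact/intertwine_choi_map.
move=> [psdX chJ inc pres].
have [psdJ ptJ] := (channel_choi_map J).1 chJ.
split=> //; apply/intertwine_choi_map.
  by apply/(block_incoherentP projP) => // ?; exact: channel_density.
by apply/subspace_preservingP => // ?; exact: channel_density.
Qed.

End Embedding.
End States.

(** * Compactness of the feasible set *)

Section Continuity.
Variables (R : realType) (T : topologicalType).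
Implicit Types F G : T -> R[i].

(** Continuity is asked of the real and imaginary parts because feasible points will be parametrised
    by real row vectors. *)
Definition ccont F : Prop :=
  continuous (fun v => complex.Re (F v)) /\ continuous (fun v => complex.Im (F v)).

Lemma ccont_cst c : ccont (fun=> c).
Proof. by split=> v; exact: cvg_cst. Qed.

Lemma ccontD F G : ccont F -> ccont G -> ccont (fun v => F v + G v).
Proof.
move=> [rF iF] [rG iG]; split=> v.
  rewrite (_ : (fun v => _) = (fun v => complex.Re (F v) + complex.Re (G v))).
    by apply: cvgD; [exact: rF | exact: rG].
  by apply/funext => w; case: (F w) (G w) => a b [].
rewrite (_ : (fun v => _) = (fun v => complex.Im (F v) + complex.Im (G v))).
  by apply: cvgD; [exact: iF | exact: iG].
by apply/funext => w; case: (F w) (G w) => a b [].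
Qed.

Lemma ccontM F G : ccont F -> ccont G -> ccont (fun v => F v * G v).
Proof.
move=> [rF iF] [rG iG]; split=> v.
  rewrite (_ : (fun v => _) = (fun v => complex.Re (F v) * complex.Re (G v) -
    complex.Im (F v) * complex.Im (G v))).
    by apply: cvgB; apply: cvgM; [exact: rF | exact: rG | exact: iF | exact: iG].
  by apply/funext => w; case: (F w) (G w) => a b [].
rewrite (_ : (fun v => _) = (fun v => complex.Re (F v) * complex.Im (G v) +
    complex.Im (F v) * complex.Re (G v))).
  by apply: cvgD; apply: cvgM; [exact: rF | exact: iG | exact: iF | exact: rG].
by apply/funext => w; case: (F w) (G w) => a b [].
Qed.

Lemma ccontJ F : ccont F -> ccont (fun v => (F v)^*).
Proof.
move=> [rF iF]; split=> v.
  rewrite (_ : (fun v => _) = (fun v => complex.Re (F v))); first exact: rF.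
  by apply/funext => w; case: (F w).
rewrite (_ : (fun v => _) = (fun v => - complex.Im (F v))).
  by apply: cvgN; exact: iF.
by apply/funext => w; case: (F w).
Qed.

Lemma ccont_sum (I : Type) (r : seq I) (F : I -> T -> R[i]) :
  (forall i, ccont (F i)) -> ccont (fun v => \sum_(i <- r) F i v).
Proof.
move=> cF; elim: r => [|i r IH].
  by under eq_fun do rewrite big_nil; exact: ccont_cst.
by under eq_fun do rewrite big_cons; exact: ccontD.
Qed.

(** The order of the complex numbers makes this the conjunction of a closed condition on the real
    part and the vanishing of the imaginary part. *)
Lemma closed_ccont_ge0 F : ccont F -> closed [set v | 0 <= F v].
Proof.
move=> [rF iF].
rewrite (_ : [set _ | _] = (fun v => complex.Re (F v)) @^-1` [set x | 0 <= x] `&`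
                      (fun v => complex.Im (F v)) @^-1` [set x | x = 0]).
  apply: closedI; apply: preimage_closed.
  - by move=> v _; exact: rF.
  - exact: closed_ge.
  - by move=> v _; exact: iF.
  - exact: closed_eq.
apply/seteqP; split=> v /=; rewrite lecE /=.
  by move=> /andP [/eqP <-].
by move=> [-> ->]; rewrite eqxx.
Qed.

Definition mxcont m n (A : T -> 'M[R[i]]_(m, n)) : Prop :=
  forall i j, ccont (fun v => A v i j).

Lemma mxcont_cst m n (A : 'M[R[i]]_(m, n)) : mxcont (fun=> A).
Proof. by move=> i j; exact: ccont_cst. Qed.

Lemma mxcontMl m n p (M : 'M[R[i]]_(m, n)) (A : T -> 'M[R[i]]_(n, p)) :
  mxcont A -> mxcont (fun v => M *m A v).
Proof.
move=> cA i j; under eq_fun do rewrite mxE.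
by apply: ccont_sum => l; apply: ccontM => //; exact: ccont_cst.
Qed.

Lemma mxcontMr m n p (M : 'M[R[i]]_(n, p)) (A : T -> 'M[R[i]]_(m, n)) :
  mxcont A -> mxcont (fun v => A v *m M).
Proof.
move=> cA i j; under eq_fun do rewrite mxE.
by apply: ccont_sum => l; apply: ccontM => //; exact: ccont_cst.
Qed.

Lemma mxcontZ m n c (A : T -> 'M[R[i]]_(m, n)) :
  mxcont A -> mxcont (fun v => c *: A v).
Proof.
by move=> cA i j; under eq_fun do rewrite mxE; exact/ccontM/cA/ccont_cst.
Qed.

Lemma mxcontB m n (A B : T -> 'M[R[i]]_(m, n)) :
  mxcont A -> mxcont B -> mxcont (fun v => A v - B v).
Proof.
move=> cA cB i j; under eq_fun do rewrite 2!mxE -mulN1r.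
by apply: ccontD => //; apply: ccontM => //; exact: ccont_cst.
Qed.

Lemma mxcont_trmxC m n (A : T -> 'M[R[i]]_(m, n)) :
  mxcont A -> mxcont (fun v => (A v) ^t*).
Proof. by move=> cA i j; under eq_fun do rewrite 2!mxE; exact: ccontJ. Qed.

Lemma mxcont_block m1 m2 n1 n2 (A : T -> 'M[R[i]]_(m1, n1))
    (B : T -> 'M[R[i]]_(m1, n2)) (D : T -> 'M[R[i]]_(m2, n1))
    (F : T -> 'M[R[i]]_(m2, n2)) :
  mxcont A -> mxcont B -> mxcont D -> mxcont F ->
  mxcont (fun v => block_mx (A v) (B v) (D v) (F v)).
Proof.
move=> cA cB cD cF i j; case: (split_ordP i) => i' ->; case: (split_ordP j) => j' ->.
- by under eq_fun do rewrite block_mxEul.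
- by under eq_fun do rewrite block_mxEur.
- by under eq_fun do rewrite block_mxEdl.
- by under eq_fun do rewrite block_mxEdr.
Qed.

Lemma mxcont_reshuffle n (J : T -> 'M[R[i]]_(n * n)) :
  mxcont J -> mxcont (fun v => reshuffle (J v)).
Proof.
move=> cJ p q; case: (mxtens_indexP p) (mxtens_indexP q) => a b [i j].
by under eq_fun do rewrite reshuffleE.
Qed.

Lemma mxcont_partial_trace1 m n (J : T -> 'M[R[i]]_(m * n)) :
  mxcont J -> mxcont (fun v => partial_trace1 (J v)).
Proof.
by move=> cJ i j; under eq_fun do rewrite mxE; apply: ccont_sum.
Qed.

Lemma mxcont_unvec n (w : T -> 'cV[R[i]]_(n * n)) :
  mxcont w -> mxcont (fun v => unvec (w v)).
Proof. by move=> cw i j; under eq_fun do rewrite mxE. Qed.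

Lemma closed_psd n (A : T -> 'M[R[i]]_n) :
  mxcont A -> closed [set v | psd (A v)].
Proof.
move=> cA; rewrite (_ : [set _ | _] =
    \bigcap_(u in [set: 'cV[R[i]]_n]) [set v | 0 <= (u ^t* *m A v *m u) 0 0]).
  apply: closed_bigI => u _; apply: closed_ccont_ge0.
  exact/mxcontMr/mxcontMl.
by apply/seteqP; split=> [v hv u _|v hv u]; [exact: hv | exact: (hv u)].
Qed.

(** Each entrywise equality is split into two opposite inequalities, so closedness follows from the
    case of the order. *)
Lemma closed_mxeq m n (A B : T -> 'M[R[i]]_(m, n)) :
  mxcont A -> mxcont B -> closed [set v | A v = B v].
Proof.
move=> cA cB; rewrite (_ : [set _ | _] =
    \bigcap_(p in [set: 'I_m * 'I_n])
      ([set v | 0 <= (A v - B v) p.1 p.2] `&` [set v | 0 <= (B v - A v) p.1 p.2])).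
  apply: closed_bigI => p _.
  by apply: closedI; apply: closed_ccont_ge0; exact: mxcontB.
apply/seteqP; split=> [v AB p _|v hv /=].
  by rewrite /= AB subrr mxE.
apply/matrixP => i j; have [] := hv (i, j) I => /=.
by rewrite !mxE !subr_ge0 => le1 le2; apply/le_anti; rewrite le1 le2.
Qed.

End Continuity.

(** * Real coordinates for finite families of complex numbers *)

Section Coordinates.
Variables (R : realType) (I : finType).
Local Notation V := 'rV[R]_#|{: I * bool}|.

Definition ccoord (v : V) (x : I) : R[i] :=
  (v 0 (enum_rank (x, false)) +i* v 0 (enum_rank (x, true)))%C.

Lemma ccont_ccoord x : ccont (ccoord ^~ x).
Proof. by split=> v; exact: coord_continuous. Qed.

Lemma ccoord_surj (f : I -> R[i]) : exists v, ccoord v =1 f.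
Proof.
exists (\row_l let p := enum_val l in
  if p.2 then complex.Im (f p.1) else complex.Re (f p.1)) => x.
by rewrite /ccoord !mxE !enum_rankK /=; case: (f x).
Qed.

(** A bound on the moduli bounds all real and imaginary parts, which makes the set a closed subset
    of a cube. *)
Lemma ccoord_compact (S : set V) (c : R) : closed S ->
  (forall v x, S v -> `|ccoord v x| <= c%:C%C) -> compact S.
Proof.
move=> clS bS; apply: (subclosed_compact clS
  (@rV_compact _ _ (fun=> `[- c, c]) (fun=> @segment_compact R (- c) c))).
move=> v Sv l /=; rewrite in_itv /= -ler_norml.
have := bS v (enum_val l).1 Sv; rewrite -lecR; apply: le_trans.
rewrite -(enum_valK l); move: (enum_val l) => -[x []] /=; rewrite enum_rankK /=.
  by rewrite normc_def lecR -sqrtr_sqr ler_wsqrtr // lerDr sqr_ge0.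
exact: (normc_ge_Re (ccoord v x)).
Qed.

End Coordinates.

(** * Existence of an optimal point of the program *)

Section Program.
Variables (R : realType) (d k n : nat).
Local Notation C := R[i].
Local Notation D := (d + k)%N.
Variables (P : 'I_n -> 'M[C]_(d + k)) (rho sigma : 'M[C]_d).
Hypotheses (projP : projective_measurement P).
Hypotheses (state_rho : density rho) (state_sigma : density sigma).

Lemma density_sdp_output X J :
  sdp_feasible P rho sigma X J -> density (sdp_output J rho).
Proof.
move=> /(sdp_feasibleP _ _ _ _ projP) [_ _ _ pres]; rewrite sdp_outputE.
have [|tau dtau <-] := pres (choi_map J (embed k rho)); last by rewrite embedK.
by exists (embed k rho) => //; exists rho.
Qed.

(** The identity channel preserves every set of states, and [fidelity_attained] completes it with an
    [X]. *)
Lemma sdp_feasible_trivial : exists X J, sdp_feasible P rho sigma X J.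
Proof.
have [X [psdX _]] := fidelity_attained state_rho.1 state_sigma.1.
exists X, (choi (idfun : 'M[C]_(d + k) -> 'M[C]_(d + k))).
apply/(sdp_feasibleP _ _ _ _ projP).
have -> : choi_map (choi (idfun : 'M[C]_(d + k) -> 'M[C]_(d + k))) = idfun.
  by apply/funext => Y; exact: (choiK idfun).
have ampl_id r (Y : 'M[C]_(D * r)) : ampliation idfun Y = Y.
  by apply: tens_matrixP => a i b j; rewrite ampliationE /= mxE.
split.
- by rewrite embedK.
- by split=> [a Y Z|r Y psdY|Y]; rewrite ?ampl_id.
- by move=> _ [Y hY <-].
- by move=> _ [Y hY <-].
Qed.

(** The block has trace 2, from the two states on its diagonal, and [J] has trace 1, from its
    partial trace; [psd_entry_le] doubles these values. *)
Lemma sdp_feasible_bound X J : sdp_feasible P rho sigma X J ->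
  (forall i j, `|X i j| <= 4) /\ (forall p q, `|J p q| <= 4).
Proof.
move=> feas; have [_ tro] := density_sdp_output feas.
have [psdX psdJ ptJ _ _] := feas; split=> [i j|p q].
  have := psd_entry_le (lshift d i) (rshift d j) psdX.
  rewrite block_mxEur mxtrace_block tro; have [_ ->] := state_sigma.
  by rewrite (_ : 2 * (1 + 1) = 4 :> C) //; ring.
apply: le_trans (psd_entry_le p q psdJ) _.
have -> : \tr J = \tr (partial_trace1 J).
  rewrite /mxtrace sum_tens exchange_big /=; apply: eq_bigr => i _.
  by rewrite mxE.
rewrite ptJ mxtrace_scalar -[_^-1 *+ _]mulr_natr mulVf ?mulr1 ?ler_nat //.
exact: dim_neq0 (mxtens_unindex p).1.
Qed.

Lemma sdp_feasible_max : exists X J, sdp_feasible P rho sigma X J /\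
  forall X' J', sdp_feasible P rho sigma X' J' -> sdp_objective X' <= sdp_objective X.
Proof.
(* The disjoint union indexes the entries of [X] and [J] jointly, so that a feasible pair becomes
   one real vector and the extreme value theorem applies. *)
pose I : finType := ('I_d * 'I_d + 'I_(D * D) * 'I_(D * D))%type.
pose X v : 'M[C]_d := \matrix_(i, j) ccoord (I := I) v (inl (i, j)).
pose J v : 'M[C]_(D * D) := \matrix_(i, j) ccoord (I := I) v (inr (i, j)).
pose S := [set v | sdp_feasible P rho sigma (X v) (J v)].
have cX : mxcont X by move=> i j; under eq_fun do rewrite mxE; exact: ccont_ccoord.
have cJ : mxcont J by move=> i j; under eq_fun do rewrite mxE; exact: ccont_ccoord.
have XJ_surj X' J' : exists v, X v = X' /\ J v = J'.
  have [v vE] := @ccoord_surj R I (fun x => match x with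
    inl p => X' p.1 p.2 | inr p => J' p.1 p.2 end).
  by exists v; split; apply/matrixP => i j; rewrite mxE vE.
have clS : closed S.
  pose hD := map_matrix (block_dephasing P).
  pose hO := map_matrix (@subspace_compression C d k).
  rewrite (_ : S =
     [set v | psd (block_mx sigma (X v) ((X v) ^t*) (sdp_output (J v) rho))]
     `&` [set v | psd (J v)]
     `&` [set v | partial_trace1 (J v) = (D%:R^-1)%:M]
     `&` [set v | reshuffle (J v) *m hD = hD *m reshuffle (J v) *m hD]
     `&` [set v | reshuffle (J v) *m hO = hO *m reshuffle (J v) *m hO]); last first.
    apply/seteqP; split=> v; first by move=> [].
    by move=> [[[[? ?] ?] ?] ?].
  have cR := mxcont_reshuffle cJ.
  have cRM M : mxcont (fun v => M *m reshuffle (J v) *m M).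
    exact/mxcontMr/mxcontMl.
  have cO : mxcont (fun v => sdp_output (J v) rho).
    exact/mxcont_unvec/mxcontZ/mxcontMr/mxcontMr/mxcontMl.
  repeat apply: closedI.
  - apply: closed_psd; apply: mxcont_block => //; first exact: mxcont_cst.
    exact: mxcont_trmxC.
  - exact: closed_psd.
  - by apply: closed_mxeq; [exact: mxcont_partial_trace1 | exact: mxcont_cst].
  - exact: closed_mxeq (mxcontMr hD cR) (cRM hD).
  - exact: closed_mxeq (mxcontMr hO cR) (cRM hO).
have cptS : compact S.
  apply: (ccoord_compact (c := 4)) => // v x /sdp_feasible_bound [bX bJ].
  rewrite rmorph_nat.
  case: x => -[i j]; first by have := bX i j; rewrite mxE.
  by have := bJ i j; rewrite mxE.
have S0 : S !=set0.
  have [X' [J' feas]] := sdp_feasible_trivial.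
  by have [v [vX vJ]] := XJ_surj X' J'; exists v; rewrite /S /= vX vJ.
have cobj : continuous (fun v => sdp_objective (X v)).
  have [//] : ccont (fun v => 2^-1 * (\tr (X v) + \tr ((X v) ^t*))).
  apply: ccontM; first exact: ccont_cst.
  by apply: ccontD; apply: ccont_sum => i //; exact: mxcont_trmxC.
have [v0] := EVT_max_rV S0 cptS (continuous_subspaceT cobj).
move=> /set_mem Sv0 maxv0; exists (X v0), (J v0); split=> // X' J' feas.
have [v [vX vJ]] := XJ_surj X' J'.
by rewrite -vX; apply/maxv0/mem_set; rewrite /S /= vX vJ.
Qed.

End Program.

(** * Comparison of the two optimal values *)

Lemma sdp_objectiveE (R : realType) d (X : 'M[R[i]]_d) :
  sdp_objective X = complex.Re (\tr X).
Proof.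
rewrite /sdp_objective mxtrace_trmxC.
have -> : \tr X + (\tr X)^* = 2 * (complex.Re (\tr X))%:C%C.
  exact: addcJ.
by rewrite mulrA mulVf ?mul1r // pnatr_eq0.
Qed.

Lemma fidelity_sdp (R : realType) d (A B : 'M[R[i]]_d) : psd A -> psd B ->
  exists X, psd (block_mx B X (X ^t*) A) /\ sdp_objective X = fidelity A B.
Proof.
move=> psdA psdB; have [X [psdX trX]] := fidelity_attained psdA psdB.
by exists X; split=> //; rewrite sdp_objectiveE trX.
Qed.

Lemma sdp_objective_le_fidelity (R : realType) d (A B X : 'M[R[i]]_d) :
  psd (block_mx B X (X ^t*) A) -> sdp_objective X <= fidelity A B.
Proof.
move=> /fidelity_upper; rewrite sdp_objectiveE /fidelity.
set x := \tr X; set f := \tr _ => le.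
have : (2 * (complex.Re x)%:C)%C <= 2 * f by rewrite -addcJ.
rewrite ler_pM2l ?ltr0n // lecE => /andP [_].
by case: (f).
Qed.

Theorem proposition7 (R : realType) (d k n : nat)
    (E : 'I_n -> 'M[R[i]]_d) (P : 'I_n -> 'M[R[i]]_(d + k))
    (rho sigma : 'M[R[i]]_d)
    (povmE : povm E) (naimarkP : naimark_extension E P)
    (state_rho : density rho) (state_sigma : density sigma) :
  exists Fmax : R,
    is_maximum [set fidelity (Lam rho) sigma
               | Lam in [set Lam | povm_incoherent_op P Lam]] Fmax /\
    isLub [set v : R | exists X J,
             sdp_feasible P rho sigma X J /\ v = sdp_objective X] Fmax.
Proof.
have [projP _] := naimarkP.
have [X0 [J0 [feas0 max0]]] := sdp_feasible_max projP state_rho state_sigma.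
(* Each operation yields a feasible pair whose objective is its fidelity: [J] comes from its channel
   and [X] attains the fidelity. *)
have feasible_op Lam : povm_incoherent_op P Lam -> exists X J,
    sdp_feasible P rho sigma X J /\ sdp_objective X = fidelity (Lam rho) sigma.
  move=> [Lam' [chLam' inc pres LamE]].
  have [J eJ] := channel_ex_choi chLam'; rewrite -{Lam'}eJ in chLam' inc pres LamE.
  have [psdLam _] : density (Lam rho).
    rewrite LamE //; have [|tau dtau <-] := pres (choi_map J (embed k rho)).
      by exists (embed k rho) => //; exists rho.
    by rewrite embedK.
  have [X [psdX objX]] := fidelity_sdp psdLam state_sigma.1.
  exists X, J; split; last exact: objX.
  apply/(sdp_feasibleP _ _ _ _ projP).
  by split; [rewrite -LamE | exact: chLam' | exact: inc | exact: pres].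
pose Lam0 r := unembed (choi_map J0 (embed k r)).
have [psdX0 ch0 inc0 pres0] := (sdp_feasibleP _ _ _ _ projP).1 feas0.
have pic0 : povm_incoherent_op P Lam0 by exists (choi_map J0).
(* The objective is at most the fidelity by the upper bound for positive blocks. Conversely,
   [feasible_op] realises this fidelity as an objective value, which cannot exceed the optimum. *)
have fid0 : fidelity (Lam0 rho) sigma = sdp_objective X0.
  apply/le_anti; rewrite (sdp_objective_le_fidelity psdX0) andbT.
  by have [X [J [feas <-]]] := feasible_op _ pic0; exact: max0 feas.
exists (sdp_objective X0); split; split.
- by exists Lam0.
- by move=> _ [Lam /feasible_op [X [J [feas <-]]] <-]; exact: max0 feas.
- by move=> _ [X [J [feas ->]]]; exact: max0 feas.
- by move=> b; apply; exists X0, J0.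
Qed.
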